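(* The record-setters $v$ of the Stern sequence with $2^{k-1}\le v<2^k$ (the ''$k$-bit record-setters'') are, for $k<12$: $k=1$: $1$; $k=2$: $3$; $k=3$: $5$; $k=4$: $9, 11$; $k=5$: $19, 21$; $k=6$: $35, 37, 43$; $k=7$: $69, 73, 75, 83, 85$; $k=8$: $139, 147, 149, 165, 171$; $k=9$: $277, 293, 299, 331, 339, 341$; $k=10$: $555, 587, 595, 597, 661, 683$; $k=11$: $1109, 1173, 1189, 1195, 1323, 1355, 1363, 1365$. For $k\ge 12$, the $k$-bit record-setters, listed in increasing order, have the following base-$2$ representations: - if $k=2n$ is even: $100\,(10)^a\,0\,(10)^{n-3-a}\,11$ for $0\le a\le n-3$; then $(10)^b\,0\,(10)^{n-b-1}\,1$ for $1\le b\le\lfloor n/2\rfloor$; then $(10)^{n-1}\,11$. - if $k=2n+1$ is odd: $1000\,(10)^{n-2}\,1$; then $100100\,(10)^{n-4}\,011$; then $100\,(10)^b\,0\,(10)^{n-2-b}\,1$ for $1\le b\le\lceil n/2\rceil-1$; then $(10)^{a+1}\,0\,(10)^{n-2-a}\,11$ for $0\le a\le n-2$; then $(10)^n\,1$. In particular, for $k\ge 12$ the number of $k$-bit record-setters is $\lfloor 3k/4\rfloor-(-1)^k$. *)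

(* Defs.v *)
From mathcomp Require Import all_boot all_order all_algebra.
Set Implicit Arguments. Unset Strict Implicit. Unset Printing Implicit Defensive.

(* Stern's diatomic sequence: s(0)=0, s(1)=1, s(2n)=s(n), s(2n+1)=s(n)+s(n+1).
   Defined with fuel; fuel n suffices for argument n (arguments strictly
   decrease for n >= 2). *)
Fixpoint stern_fuel (fuel n : nat) : nat :=
  match fuel with
  | 0 => 0
  | f.+1 =>
      if n <= 1 then n
      else if odd n then stern_fuel f n./2 + stern_fuel f (n./2).+1
      else stern_fuel f n./2
  end.

Definition stern (n : nat) : nat := stern_fuel n n.

Definition record_setter (v : nat) : bool :=
  all (fun i => stern i < stern v) (iota 0 v).

Definition kbit_record_setters (k : nat) : seq nat :=
  [seq v <- iota (2 ^ k.-1) (2 ^ k - 2 ^ k.-1) | record_setter v].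

Definition bin_val (w : seq bool) : nat :=
  foldl (fun acc (b : bool) => acc.*2 + b) 0 w.

Definition w10 : seq bool := [:: true; false].
Definition rep (n : nat) (w : seq bool) : seq bool := flatten (nseq n w).

Notation "'b0" := [:: false].
Notation "'b1" := [:: true].

Definition even_list (n : nat) : seq nat :=
  [seq bin_val ([:: true; false; false] ++ rep a w10 ++ 'b0 ++ rep (n - 3 - a) w10
                 ++ [:: true; true]) | a <- iota 0 (n - 2)]
  ++ [seq bin_val (rep b w10 ++ 'b0 ++ rep (n - b - 1) w10 ++ 'b1)
        | b <- iota 1 (n./2)]
  ++ [:: bin_val (rep (n - 1) w10 ++ [:: true; true])].

Definition odd_list (n : nat) : seq nat :=
  [:: bin_val ([:: true; false; false; false] ++ rep (n - 2) w10 ++ 'b1);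
      bin_val ([:: true; false; false; true; false; false] ++ rep (n - 4) w10
               ++ [:: false; true; true])]
  ++ [seq bin_val ([:: true; false; false] ++ rep b w10 ++ 'b0 ++ rep (n - 2 - b) w10
                   ++ 'b1) | b <- iota 1 (uphalf n - 1)]
  ++ [seq bin_val (rep a.+1 w10 ++ 'b0 ++ rep (n - 2 - a) w10 ++ [:: true; true])
        | a <- iota 0 (n - 1)]
  ++ [:: bin_val (rep n w10 ++ 'b1)].

Example stern_test : map stern (iota 0 10) = [:: 0; 1; 1; 2; 1; 3; 2; 3; 1; 4].
Proof. by []. Qed.
Example ex6 : kbit_record_setters 6 = [:: 35; 37; 43].
Proof. by vm_compute. Qed.

(* Main.v *)
(* Reading v bit by bit from the left acts linearly on the pair (s(u), s(u+1)) of Stern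
   values of the prefix u read so far, and among all m-bit continuations of u the largest
   value is max F_(m+1) + min F_m, F being the Fibonacci sequence and max, min those of
   s(u), s(u+1).  If x = c0y and x' = c1z are consecutive in the list, with c their longest
   common prefix, then x attains the maximum over all words beginning with c0, while a word
   between x and x' beginning with c1 agrees with x' up to a 1 of z that it replaces by a
   0; the cylinder maximum at that 0 never exceeds s(x).  As s(x) < s(x'), the list is the
   complete list of records.  It starts after the last (k-1)-bit record, of value F_k, and
   it ends at F_(k+1), the maximum over all k-bit numbers. *)
Require Import Defs.
From mathcomp Require Import all_boot all_order all_algebra.
From mathcomp Require Import zify.
Import GRing.Theory Num.Theory.

Set Implicit Arguments.
Unset Strict Implicit.
Unset Printing Implicit Defensive.

(** * Values of the Stern sequence *)

Lemma stern_fuelS f n :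
  stern_fuel f.+1 n =
  if n <= 1 then n
  else if odd n then stern_fuel f n./2 + stern_fuel f (n./2).+1
  else stern_fuel f n./2.
Proof. by []. Qed.

Lemma stern_fuel_enough f g n :
  n <= f -> n <= g -> stern_fuel f n = stern_fuel g n.
Proof.
elim: f g n => [|f IH] [|g] n lef leg //.
- by have -> : n = 0 by lia.
- by have -> : n = 0 by lia.
rewrite !stern_fuelS; case: leqP => // n1.
case: ifP => oddn; first congr (_ + _); apply: IH; lia.
Qed.

Lemma stern_gt1 n :
  1 < n -> stern n = if odd n then stern n./2 + stern n./2.+1 else stern n./2.
Proof.
case: n => // n n1; rewrite /stern stern_fuelS leqNgt n1 [~~ true]/=.
by case: ifP => oddn; first congr (_ + _); apply: stern_fuel_enough; lia.
Qed.

Lemma stern_double n : stern n.*2 = stern n.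
Proof. by case: n => // n; rewrite stern_gt1 ?odd_double ?doubleK. Qed.

Lemma stern_doubleS n : stern n.*2.+1 = stern n + stern n.+1.
Proof.
case: n => // n; rewrite stern_gt1 // oddS odd_double.
by rewrite -[_./2]/(uphalf n.+1.*2) uphalf_double.
Qed.

Fixpoint fib n :=
  if n is n'.+1 then (if n' is n''.+1 then fib n' + fib n'' else 1) else 0.

Lemma fibSS n : fib n.+2 = fib n.+1 + fib n.
Proof. by []. Qed.

(** Appending a bit turns the pair $(a,b)$ into $(a,a+b)$ or $(a+b,b)$: the new maximum is $a+b$,
    the new minimum is at most $\max(a,b)$, and the Fibonacci recurrence closes the induction. *)
Lemma stern_cylinder m u v :
  u * 2 ^ m <= v < u.+1 * 2 ^ m ->
  stern v <= maxn (stern u) (stern u.+1) * fib m.+1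
             + minn (stern u) (stern u.+1) * fib m.
Proof.
elim: m u => [|m IH] u.
  by rewrite expn0 => uv; have -> : v = u by [lia]; rewrite /=; lia.
rewrite expnS => uv; have [lev|ltv] := ltnP v (u.*2.+1 * 2 ^ m).
  have := IH u.*2; rewrite stern_double stern_doubleS fibSS; nia.
have := IH u.*2.+1; rewrite stern_doubleS -doubleS stern_double fibSS; nia.
Qed.

(** The largest Stern value on the cylinder of [c ++ 0 ++ w], [size w = m], where [c]
    leads to the pair [(a, b)] of consecutive Stern values; the general formula would
    overestimate it at [m = 0]. *)
Definition cyl0 a b m :=
  if m is 0 then a else (a + b) * fib m.+1 + a * fib m.

Arguments cyl0 : simpl never.

Lemma stern_cyl0 m u v :
  u.*2 * 2 ^ m <= v < u.*2.+1 * 2 ^ m -> stern v <= cyl0 (stern u) (stern u.+1) m.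
Proof.
case: m => [|m] uv.
  by rewrite -(stern_double u) /= (_ : v = u.*2) //; lia.
have := stern_cylinder uv; rewrite stern_double stern_doubleS /cyl0; nia.
Qed.

Definition append_bit u (b : bool) := u.*2 + b.

Lemma append_bit0 u : append_bit u false = u.*2.
Proof. exact: addn0. Qed.

Lemma append_bit1 u : append_bit u true = u.*2.+1.
Proof. exact: addn1. Qed.

Definition step_pair (ab : nat * nat) (bit : bool) :=
  if bit then (ab.1 + ab.2, ab.2) else (ab.1, ab.1 + ab.2).

Definition run a b w := (foldl step_pair (a, b) w).1.

Lemma stern_append u w :
  (stern (foldl append_bit u w), stern (foldl append_bit u w).+1) =
  foldl step_pair (stern u, stern u.+1) w.
Proof.
elim: w u => //= bit w IH u; rewrite IH /step_pair; congr foldl.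
case: bit; first by rewrite append_bit1 stern_doubleS -doubleS stern_double.
by rewrite append_bit0 stern_doubleS stern_double.
Qed.

Lemma stern_run u w :
  stern (foldl append_bit u w) = run (stern u) (stern u.+1) w.
Proof. by rewrite /run -stern_append. Qed.

Lemma foldl_append_bounds u w :
  u * 2 ^ size w <= foldl append_bit u w < u.+1 * 2 ^ size w.
Proof.
elim: w u => [|bit w IH] u; first by rewrite !muln1 /=; lia.
by have := IH (append_bit u bit); rewrite /append_bit /= expnS; nia.
Qed.

(** Every word smaller than [w] agrees with [w] up to some bit [1] of [w] and has a [0]
    there, so it lies in one of the cylinders tested here. *)
Fixpoint below (T a b : nat) (w : seq bool) : Prop :=
  if w is bit :: w' then
    if bit then cyl0 a b (size w') <= T /\ below T (a + b) b w'
    else below T a (a + b) w'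
  else True.

Lemma stern_below T u w v :
  below T (stern u) (stern u.+1) w ->
  u * 2 ^ size w <= v < foldl append_bit u w -> stern v <= T.
Proof.
elim: w u => [|bit w IH] u; first by rewrite !muln1 /=; lia.
case: bit => /=.
  case=> cylT belowT; rewrite expnS => uv.
  have [lev|ltv] := ltnP v (u.*2.+1 * 2 ^ size w).
    by apply: leq_trans cylT; apply: stern_cyl0; lia.
  apply: (IH (append_bit u true)); last by rewrite append_bit1 in uv *; lia.
  by rewrite append_bit1 stern_doubleS -doubleS stern_double.
move=> belowT; rewrite expnS => uv; apply: (IH (append_bit u false)).
  by rewrite append_bit0 stern_doubleS stern_double.
by rewrite append_bit0 in uv *; lia.
Qed.

(** * Consecutive records *)

Definition next_record x y :=
  [/\ x < y, stern x < stern y & forall v, x <= v < y -> stern v <= stern x].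

(** [c ++ 0 ++ y] is followed by [c ++ 1 ++ z] as soon as the former maximises the Stern
    sequence on the cylinder of [c ++ 0]. *)
Definition next_suffix a b y z :=
  let T := run a (a + b) y in
  [/\ size y = size z, cyl0 a b (size z) <= T, below T (a + b) b z
    & T < run (a + b) b z].

Lemma next_suffix_record a b c y z :
  foldl step_pair (0, 1) c = (a, b) -> next_suffix a b y z ->
  next_record (bin_val (c ++ false :: y)) (bin_val (c ++ true :: z)).
Proof.
move=> cab [szyz cylT belowT ltT].
rewrite /bin_val !foldl_cat; move: (stern_append 0 c).
rewrite -!/append_bit; set u := foldl _ 0 c; rewrite cab => -[ua ub].
have sy : stern (foldl append_bit u (false :: y)) = run a (a + b) y.
  by rewrite stern_run ua ub.
have sz : stern (foldl append_bit u (true :: z)) = run (a + b) b z.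
  by rewrite stern_run ua ub.
have by_ := foldl_append_bounds (append_bit u false) y.
have bz := foldl_append_bounds (append_bit u true) z.
rewrite /= append_bit0 append_bit1 in by_ bz *.
split; first by rewrite szyz in by_; lia.
  by move: sy sz => /=; rewrite append_bit0 append_bit1 => -> ->.
move=> v /andP[yv vz].
move: sy => /=; rewrite append_bit0 => ->.
(* For [true :: z] read from [u], [below] unfolds to [cylT] and [belowT], so the words beginning
   with [c ++ 'b0] are covered too. *)
apply: (@stern_below _ u (true :: z)); first by rewrite ua ub.
by rewrite /= append_bit1 expnS -szyz; lia.
Qed.

Fixpoint chain x (s : seq nat) : Prop :=
  if s is y :: s' then next_record x y /\ chain y s' else True.

Lemma chain_le_last x s : chain x s -> x <= last x s.
Proof.
by elim: s x => //= y s IH x [[xy _ _] /IH]; apply: leq_trans; apply: ltnW.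
Qed.

Lemma chain_map x (f : nat -> nat) a n s :
  next_record x (f a) ->
  (forall i, a <= i < a + n -> next_record (f i) (f i.+1)) ->
  chain (f (a + n)) s -> chain x ([seq f i | i <- iota a n.+1] ++ s).
Proof.
elim: n x a => [|n IH] x a xa fS; first by rewrite addn0.
move=> fs; split=> //; apply: IH.
- by apply: fS; lia.
- by move=> i ?; apply: fS; lia.
- by rewrite addSnnS.
Qed.

(** Invariant: [p] attains the maximum below [lo]. Hence the next entry [x], of larger value, is at
    least [lo], nothing from [lo] up to [x] is a record, and the induction goes on with [x] and
    [x.+1]. *)
Lemma records_chain p s lo hi :
  p < lo -> (forall v, v < lo -> stern v <= stern p) ->
  chain p s -> last p s < hi -> (forall v, v < hi -> stern v <= stern (last p s)) ->
  [seq v <- iota lo (hi - lo) | record_setter v] = s.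
Proof.
elim: s p lo => [|x s IH] p lo plo maxp /=.
  move=> _ _ maxhi; apply/eqP; rewrite -[_ == _]negbK -has_filter.
  apply/hasPn => v; rewrite mem_iota => vhi; apply/negP => /allP /(_ p).
  rewrite mem_iota => /(_ _)/(leq_ltn_trans (maxhi v _)); lia.
case=> [[px ltx maxx] xs] lasthi maxlast.
have lox : lo <= x by rewrite leqNgt; apply/negP => /maxp; lia.
have xhi : x < hi by apply: leq_ltn_trans (chain_le_last xs) lasthi.
have -> : hi - lo = (x - lo) + (hi - x.+1).+1 by lia.
rewrite iotaD subnKC // filter_cat /= (IH x x.+1) //.
  have -> : record_setter x.
    apply/allP => v; rewrite mem_iota => vx; have [vlo|lov] := ltnP v lo.
      by apply: leq_ltn_trans ltx; apply: maxp.
    by apply: leq_ltn_trans ltx; apply: maxx; lia.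
  rewrite (_ : [seq v <- iota lo _ | _] = [::]) //.
  apply/eqP; rewrite -[_ == _]negbK -has_filter.
  apply/hasPn => v; rewrite mem_iota => vhi; apply/negP => /allP /(_ p).
  by rewrite mem_iota => /(_ _)/(leq_ltn_trans (maxx v _)); lia.
move=> v vx; have [vp|pv] := ltnP v p.
  by apply: leq_trans (ltnW ltx); apply: maxp; lia.
have [->//|] := eqVneq v x => nx.
by apply: leq_trans (ltnW ltx); apply: maxx; lia.
Qed.

(** Both maxima come from [stern_cylinder] at [u = 0], where the pair is $(0,1)$ and the bound is
    [fib m.+1]. *)
Lemma kbit_chain p s k :
  0 < k -> p < 2 ^ k.-1 -> stern p = fib k -> chain p s -> last p s < 2 ^ k ->
  stern (last p s) = fib k.+1 -> kbit_record_setters k = s.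
Proof.
case: k => //= k _ pk fp cs lk fl; apply: records_chain pk _ cs lk _ => v.
  rewrite fp => vk; have := @stern_cylinder k 0 v.
  by rewrite !mul0n !mul1n /=; lia.
rewrite fl => vk; have := @stern_cylinder k.+1 0 v.
by rewrite !mul0n !mul1n /=; lia.
Qed.

(** * The blocks [(10)^c] *)

(** [pq c = (F_(2c), F_(2c-1))], where [F_(-1) = 1]. *)
Fixpoint pq c :=
  if c is c'.+1 then let: (p, q) := pq c' in (q + 2 * p, q + p) else (0, 1).

Definition p10 c := (pq c).1.
Definition q10 c := (pq c).2.

Lemma p10S c : p10 c.+1 = q10 c + 2 * p10 c.
Proof. by rewrite /p10 /q10 /=; case: pq. Qed.

Lemma q10S c : q10 c.+1 = q10 c + p10 c.
Proof. by rewrite /p10 /q10 /=; case: pq. Qed.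

Definition pq10S := (p10S, q10S).

Lemma q10_gt0 c : 0 < q10 c.
Proof. by elim: c => // c; rewrite q10S; lia. Qed.

(** The Fibonacci addition law, with [p10 c + q10 c] as $F_{2c+1}$. *)
Lemma pq10D c d :
  p10 (c + d) = p10 c * q10 d + (p10 c + q10 c) * p10 d /\
  q10 (c + d) = q10 c * q10 d + p10 c * p10 d.
Proof.
elim: c => [|c [IHp IHq]]; first by rewrite add0n -[p10 0]/0 -[q10 0]/1; lia.
by rewrite addSn !pq10S IHp IHq; lia.
Qed.

Lemma pq10_cassini c : q10 c * (q10 c + p10 c) = p10 c * p10 c + 1.
Proof. by elim: c => // c; rewrite !pq10S; nia. Qed.

Lemma fib_pq10 c : fib c.*2 = p10 c /\ fib c.*2.+1 = p10 c + q10 c.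
Proof.
by elim: c => // c [IHp IHq]; rewrite doubleS !fibSS !pq10S IHp IHq; lia.
Qed.

(** Both ratios are convergents of the golden ratio: [p10 c / q10 c] tends to [phi] from
    below and [1 + q10 d / p10 d] from above. *)
Lemma pq10_golden c d : p10 c * p10 d <= q10 c * p10 d + q10 c * q10 d.
Proof.
elim: c d => [|c IH] [|d]; rewrite ?mul0n ?muln0 //.
by have := IH d; rewrite !pq10S; nia.
Qed.

Lemma repS c w : rep c.+1 w = w ++ rep c w.
Proof. by []. Qed.

Lemma size_rep10 c : size (rep c w10) = c.*2.
Proof. by elim: c => // c IH; rewrite repS size_cat IH doubleS. Qed.

Lemma rep_cat c d w : rep c w ++ rep d w = rep (c + d) w.
Proof. by rewrite /rep nseqD flatten_cat. Qed.

(** The block [10] acts by the matrix with rows $(1,1)$ and $(1,2)$, the square of the Fibonacci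
    matrix; its powers have entries $F_{2c-1}, F_{2c}, F_{2c+1}$. *)
Lemma pair_rep10 a b c :
  foldl step_pair (a, b) (rep c w10) =
  (a * q10 c + b * p10 c, a * p10 c + b * (p10 c + q10 c)).
Proof.
elim: c a b => [|c IH] a b; first by rewrite -[p10 0]/0 -[q10 0]/1; congr (_, _); lia.
by rewrite repS foldl_cat /= /step_pair /= IH !pq10S; congr (_, _); nia.
Qed.

Lemma run_rep10 a b c w :
  run a b (rep c w10 ++ w) =
  run (a * q10 c + b * p10 c) (a * p10 c + b * (p10 c + q10 c)) w.
Proof. by rewrite /run foldl_cat pair_rep10. Qed.

(** Only the [1] of each block gives a condition. After the one preceded by [j] blocks there remain
    its own [0], [e] blocks and [w], hence the length in the hypothesis. *)
Lemma below_rep10 T a b c w :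
  (forall j e, j + e.+1 = c ->
     cyl0 (a * q10 j + b * p10 j) (a * p10 j + b * (p10 j + q10 j))
          (e.*2.+1 + size w) <= T) ->
  below T (a * q10 c + b * p10 c) (a * p10 c + b * (p10 c + q10 c)) w ->
  below T a b (rep c w10 ++ w).
Proof.
elim: c a b => [|c IH] a b cylT wT.
  by move: wT; rewrite /= muln1 !muln0 addn0 addnC muln1 addn0.
rewrite repS /=; split.
  have := cylT 0 c erefl; rewrite -[q10 0]/1 -[p10 0]/0 size_cat size_rep10.
  by rewrite !muln1 !muln0 addn0.
apply: IH => [j e jec|].
  have := cylT j.+1 e; rewrite addSn jec => /(_ erefl); rewrite !pq10S.
  by congr (cyl0 _ _ _ <= T); lia.
by move: wT; rewrite !pq10S; congr (below T _ _ w); lia.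
Qed.

Lemma cyl0_even a b e :
  cyl0 a b e.*2.+2 = (a + b) * (2 * q10 e + 3 * p10 e) + a * (q10 e + 2 * p10 e).
Proof.
by rewrite /cyl0 -doubleS (fib_pq10 e.+1).1 (fib_pq10 e.+1).2 !pq10S; nia.
Qed.

Lemma cyl0_odd a b e :
  cyl0 a b e.*2.+1 = (a + b) * (q10 e + 2 * p10 e) + a * (q10 e + p10 e).
Proof.
by rewrite /cyl0 -doubleS (fib_pq10 e.+1).1 (fib_pq10 e).2 !pq10S; nia.
Qed.

Lemma run0 a b w : run a b (false :: w) = run a (a + b) w.
Proof. by []. Qed.

Lemma run1 a b w : run a b (true :: w) = run (a + b) b w.
Proof. by []. Qed.

Lemma run_nil a b : run a b [::] = a.
Proof. by []. Qed.

Lemma cyl0_0 a b : cyl0 a b 0 = a.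
Proof. by []. Qed.

Definition runE := (run0, run1, run_rep10, run_nil).

(** An instance of d'Ocagne's identity; it makes [p10 c / q10 c] increase with [c]. *)
Lemma pq10_cross c d : q10 (c + d) * p10 c + p10 d = p10 (c + d) * q10 c.
Proof.
have [-> ->] := pq10D c d.
have := congr1 (muln (p10 d)) (pq10_cassini c); lia.
Qed.

Lemma p10_le c : p10 c <= 2 * q10 c.
Proof. by case: c => // c; rewrite !pq10S; lia. Qed.

(** The strict form of [pq10_golden], with [c] and [d] exchanged. *)
Lemma pq10_golden_lt c d : p10 c * p10 d < (p10 c + q10 c) * q10 d.
Proof.
elim: c d => [|c IH] [|d].
- by [].
- by rewrite mul0n add0n mul1n q10_gt0.
- by rewrite muln0 muln1; have := q10_gt0 c.+1; lia.
by have := IH d; rewrite !pq10S; lia.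
Qed.

(** * Suffixes of consecutive records *)

Lemma next_suffix_shift1 a b c :
  b <= 2 * a -> a * (p10 c.+1 + q10 c.+1) < b * p10 c.+1 ->
  next_suffix a b (rep c.+1 w10 ++ [:: true])
                  [:: false, false & rep c w10 ++ [:: true]].
Proof.
(* After simplification [incr] is exactly the required increase in value; [ba] serves the cylinders
   met inside the blocks. *)
move=> ba; rewrite !pq10S => incr; rewrite /next_suffix !runE !pq10S.
split.
- by rewrite /= !size_cat !size_rep10.
- rewrite /= size_cat size_rep10 (addn1 c.*2) -doubleS.
  by rewrite cyl0_odd !pq10S; lia.
- rewrite [below _ _ _ _]/=; apply: below_rep10 => [j e <-|]; last first.
    by rewrite /= cyl0_0; split=> //; lia.
  rewrite [_ + size _]addn1 cyl0_even (addnS j) !pq10S.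
  have [-> ->] := pq10D j e.
  set p := p10 j; set q := q10 j; set r := q10 e; set s := p10 e.
  (* The factor is the coefficient of [b] in the cylinder value minus [T], so this eliminates
     [b]. *)
  have := leq_mul ba (leqnn (p * (4 * r + 6 * s) + q * (r + s))); lia.
- lia.
Qed.

Lemma next_suffix_shift2 a b c :
  b <= 3 * a -> a * p10 c.+2 < b * q10 c.+2 ->
  next_suffix a b (rep c.+1 w10 ++ [:: true; true])
                  [:: false, false & rep c w10 ++ [:: true; true]].
Proof.
move=> ba; rewrite !pq10S => incr; rewrite /next_suffix !runE !pq10S.
split.
- by rewrite /= !size_cat !size_rep10.
- rewrite /= size_cat size_rep10 (addn2 c.*2) -doubleS.
  by rewrite cyl0_even !pq10S; lia.
- rewrite [below _ _ _ _]/=; apply: below_rep10 => [j e <-|]; last first.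
    rewrite /= cyl0_0 (cyl0_odd _ _ 0) -[p10 0]/0 -[q10 0]/1.
    split; last by split=> //; lia.
    have := leq_mul ba (leqnn (p10 c)); lia.
  rewrite [_ + size _]addn2 -doubleS cyl0_odd (addnS j) !pq10S.
  have [-> ->] := pq10D j e.
  (* Once [b] is replaced by [3 * a], it remains to bound $3p(r+2s)$ by $7qr+10qs$; three times this
     inequality suffices. *)
  have := pq10_golden j e.+1; rewrite !pq10S.
  set p := p10 j; set q := q10 j; set r := q10 e; set s := p10 e => golden.
  have := leq_mul ba (leqnn (p * (6 * r + 10 * s) + q * (r + 2 * s))).
  have := leq_mul (leqnn a) golden.
  lia.
- lia.
Qed.

Lemma next_suffix_swap a b :
  a < b -> next_suffix a b [:: true; true] [:: false; true].
Proof.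
move=> ab; rewrite /next_suffix !runE; split=> //=; last lia.
  by rewrite (cyl0_even _ _ 0) -[p10 0]/0 -[q10 0]/1; lia.
by rewrite cyl0_0; split=> //; lia.
Qed.

(** [bound] has one instance per cylinder: [e = 0] for the first [1] of the final [11], the others
    for the blocks. After [j] blocks, [T] minus the cylinder value is exactly [2 * p10 j + q10 j]
    times the slack of that instance. *)
Lemma next_suffix_end a b c :
  a < b -> (forall e, e <= c -> b * p10 e.+1 <= a * (p10 e.+1 + q10 e.+1)) ->
  next_suffix a b (rep c.+1 w10 ++ [:: true])
                  (false :: rep c w10 ++ [:: true; true]).
Proof.
move=> ab bound; rewrite /next_suffix !runE !pq10S.
have ba : b <= 2 * a by have := bound 0 isT; rewrite !pq10S -[p10 0]/0 -[q10 0]/1; lia.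
split.
- by rewrite /= !size_cat !size_rep10 /=; lia.
- rewrite /= size_cat size_rep10 (addn2 c.*2) -doubleS.
  by rewrite cyl0_odd !pq10S; lia.
- rewrite [below _ _ _ _]/=; apply: below_rep10 => [j e jec|]; last first.
    rewrite /= cyl0_0 (cyl0_odd _ _ 0) -[p10 0]/0 -[q10 0]/1.
    split; last by split=> //; lia.
    have := leq_mul ba (leqnn (2 * p10 c + q10 c)); lia.
  have := bound e.+1; rewrite -{1}jec => /(_ (leq_addl _ _)).
  rewrite -jec addn2 -doubleS cyl0_odd (addnS j) !pq10S.
  have [-> ->] := pq10D j e.
  set p := p10 j; set q := q10 j; set r := q10 e; set s := p10 e => be.
  have := leq_mul be (leqnn (2 * p + q)); lia.
- have := q10_gt0 c; nia.
Qed.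

Lemma next_suffix_start_even c :
  next_suffix 0 1 (rep c.+2 w10 ++ [:: true])
                  [:: false, false, false & rep c w10 ++ [:: true; true]].
Proof.
rewrite /next_suffix !runE !pq10S; split.
- by rewrite /= !size_cat !size_rep10 /=; lia.
- rewrite /= size_cat size_rep10 (addn2 c.*2) -2!doubleS.
  by rewrite cyl0_odd !pq10S; lia.
- rewrite [below _ _ _ _]/=; apply: below_rep10 => [j e <-|]; last first.
    rewrite /= cyl0_0 (cyl0_odd _ _ 0) -[p10 0]/0 -[q10 0]/1.
    by have := q10_gt0 c; do !split=> //; lia.
  rewrite [_ + size _]addn2 -doubleS cyl0_odd (addnS j) !pq10S.
  have [-> ->] := pq10D j e.
  by have := p10_le j; have := pq10_golden j e.+1; rewrite !pq10S; lia.
- by have := q10_gt0 c; lia.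
Qed.

Lemma next_suffix_start_odd c :
  0 < c ->
  next_suffix 0 1 (rep c.+1 w10 ++ [:: true; true])
                  [:: false, false, false & rep c w10 ++ [:: true]].
Proof.
move=> c0; rewrite /next_suffix !runE !pq10S; split.
- by rewrite /= !size_cat !size_rep10 /=; lia.
- rewrite /= size_cat size_rep10 (addn1 c.*2) -doubleS.
  by rewrite cyl0_even !pq10S; lia.
- rewrite [below _ _ _ _]/=; apply: below_rep10 => [j e <-|]; last first.
    by rewrite /= cyl0_0; split=> //; lia.
  rewrite [_ + size _]addn1 cyl0_even (addnS j) !pq10S.
  have [-> ->] := pq10D j e.
  by have := p10_le j; have := pq10_golden j e.+1; rewrite !pq10S; lia.
(* The gain in value is exactly [p10 c], which vanishes at [c = 0]. *)
- by case: c c0 => // c _; rewrite !pq10S; have := q10_gt0 c; lia.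
Qed.

Lemma next_suffix_second_odd c :
  1 < c ->
  next_suffix 1 3 (rep c.+2 w10 ++ [:: true])
                  [:: false, false & rep c w10 ++ [:: false; true; true]].
Proof.
move=> c1.
rewrite /next_suffix !runE !pq10S; split.
- by rewrite /= !size_cat !size_rep10 /=; lia.
- rewrite /= size_cat size_rep10 (addn3 c.*2) -2!doubleS.
  by rewrite cyl0_odd !pq10S; lia.
- rewrite [below _ _ _ _]/=; apply: below_rep10 => [j e <-|]; last first.
    rewrite /= cyl0_0 (cyl0_odd _ _ 0) -[p10 0]/0 -[q10 0]/1.
    by do !split=> //; lia.
  rewrite [_ + size _]addn3 -doubleS cyl0_even (addnS j) !pq10S.
  have [-> ->] := pq10D j e.
  by have := pq10_golden j e.+2; rewrite !pq10S; lia.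
(* The gain in value is [3 * (p10 c - q10 c)], positive only from [c = 2] on. *)
- by case: c c1 => [|[|c]] // _; rewrite !pq10S; have := q10_gt0 c; lia.
Qed.

(** * Steps between consecutive records *)

Lemma rep10_rcons c w : rep c.+1 w10 ++ w = rep c w10 ++ [:: true, false & w].
Proof. by rewrite -addn1 -rep_cat -catA. Qed.

Lemma next_record_rep10 a b c i y z :
  foldl step_pair (0, 1) c = (a, b) ->
  next_suffix (a * q10 i + b * p10 i) (a * p10 i + b * (p10 i + q10 i)) y z ->
  next_record (bin_val (c ++ rep i w10 ++ false :: y))
              (bin_val (c ++ rep i w10 ++ true :: z)).
Proof.
move=> cab yz; rewrite !catA; apply: next_suffix_record yz.
by rewrite foldl_cat cab pair_rep10.
Qed.

Lemma next_record_rep10_nil i y z :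
  next_suffix (p10 i) (p10 i + q10 i) y z ->
  next_record (bin_val (rep i w10 ++ false :: y)) (bin_val (rep i w10 ++ true :: z)).
Proof.
move=> yz; apply: (@next_record_rep10 0 1 [::]) => //.
by rewrite !mul0n !mul1n.
Qed.

Lemma q10_le_p10 i : 0 < i -> q10 i <= p10 i.
Proof. by case: i => // i _; rewrite !pq10S; lia. Qed.

Lemma p10_gt0 i : 0 < i -> 0 < p10 i.
Proof. by move=> /q10_le_p10; apply: leq_trans; apply: q10_gt0. Qed.

Lemma pq10_ratio_le c i : c <= i -> q10 i * p10 c <= p10 i * q10 c.
Proof. by move=> /subnKC <-; have := pq10_cross c (i - c); lia. Qed.

Lemma pq10_ratio_lt c i : c < i -> q10 i * p10 c < p10 i * q10 c.
Proof.
move=> ci; have d0 : 0 < i - c by rewrite subn_gt0.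
by rewrite -(subnKC (ltnW ci)); have := pq10_cross c (i - c); have := p10_gt0 d0; lia.
Qed.

(** This prefix leads to $(1,3) = (L_1,L_2)$; after [i] further blocks the pair consists of the
    Lucas numbers $L_{2i+1}, L_{2i+2}$. *)
Definition w100 := [:: true; false; false].

Lemma next_shift2_100 i c :
  next_record (bin_val (w100 ++ rep i w10 ++ 'b0 ++ rep c.+1 w10 ++ [:: true; true]))
              (bin_val (w100 ++ rep i.+1 w10 ++ 'b0 ++ rep c w10 ++ [:: true; true])).
Proof.
rewrite [rep i.+1 _ ++ _]rep10_rcons; apply: (@next_record_rep10 1 3 w100) => //.
apply: next_suffix_shift2; first lia.
suff: (q10 i + 3 * p10 i) * p10 c.+2 < (4 * p10 i + 3 * q10 i) * q10 c.+2 by lia.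
(* The Lucas ratio lies above the golden ratio and [p10 d / q10 d] below it. Both move by one block
   per step, so [c.+2] is generalized to an independent [d]. *)
elim: i {1 2}c.+2 => [|i IH] [|d].
- by [].
- by have := p10_le d.+1; have := q10_gt0 d.+1; rewrite -[p10 0]/0 -[q10 0]/1; lia.
- by have := q10_gt0 i.+1; rewrite -[p10 0]/0 -[q10 0]/1; lia.
- by have := IH d; rewrite !pq10S; lia.
Qed.

Lemma next_shift2 i c :
  next_record (bin_val (rep i.+1 w10 ++ 'b0 ++ rep c.+1 w10 ++ [:: true; true]))
              (bin_val (rep i.+2 w10 ++ 'b0 ++ rep c w10 ++ [:: true; true])).
Proof.
rewrite [rep i.+2 _ ++ _]rep10_rcons; apply: next_record_rep10_nil.
have := q10_le_p10 (ltn0Sn i) => qp.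
apply: next_suffix_shift2; first lia.
by have := pq10_golden_lt i.+1 c.+2; lia.
Qed.

Lemma next_swap_100 i :
  next_record (bin_val (w100 ++ rep i w10 ++ 'b0 ++ [:: true; true]))
              (bin_val (w100 ++ rep i.+1 w10 ++ 'b1)).
Proof.
rewrite [rep i.+1 _ ++ _]rep10_rcons; apply: (@next_record_rep10 1 3 w100) => //.
by apply: next_suffix_swap; have := q10_gt0 i; lia.
Qed.

Lemma next_swap i :
  next_record (bin_val (rep i w10 ++ 'b0 ++ [:: true; true]))
              (bin_val (rep i.+1 w10 ++ 'b1)).
Proof.
rewrite rep10_rcons; apply: next_record_rep10_nil.
by apply: next_suffix_swap; have := q10_gt0 i; lia.
Qed.

Lemma next_shift1_100 i c :
  0 < i -> i <= c ->
  next_record (bin_val (w100 ++ rep i w10 ++ 'b0 ++ rep c.+1 w10 ++ 'b1))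
              (bin_val (w100 ++ rep i.+1 w10 ++ 'b0 ++ rep c w10 ++ 'b1)).
Proof.
move=> i0 ic; rewrite [rep i.+1 _ ++ _]rep10_rcons.
apply: (@next_record_rep10 1 3 w100) => //.
have := q10_le_p10 i0 => qp.
apply: next_suffix_shift1; first lia.
(* With [d = c.+1 - i], the two sides differ by exactly [2 * p10 d - q10 d]: cross identity,
   addition law and Cassini together. *)
have d0 : 0 < c.+1 - i by lia.
have := q10_le_p10 d0; have := p10_gt0 d0.
have := pq10_cross i (c.+1 - i); have := pq10D i (c.+1 - i).
rewrite subnKC; last lia.
case=> Ep Eq cross; have := congr1 (muln (q10 (c.+1 - i))) (pq10_cassini i).
rewrite !Ep !Eq in cross *; lia.
Qed.

Lemma next_shift1 i c :
  0 < i -> i <= c ->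
  next_record (bin_val (rep i w10 ++ 'b0 ++ rep c.+1 w10 ++ 'b1))
              (bin_val (rep i.+1 w10 ++ 'b0 ++ rep c w10 ++ 'b1)).
Proof.
move=> i0 ic; rewrite [rep i.+1 _ ++ _]rep10_rcons.
apply: next_record_rep10_nil.
have := q10_le_p10 i0 => qp.
apply: next_suffix_shift1; first lia.
by have := @pq10_ratio_lt i c.+1 ic; lia.
Qed.

Lemma next_end_100 i c :
  c < i ->
  next_record (bin_val (w100 ++ rep i w10 ++ 'b0 ++ rep c.+1 w10 ++ 'b1))
              (bin_val (w100 ++ rep (i + c).+1 w10 ++ [:: true; true])).
Proof.
move=> ci; rewrite -addSn -rep_cat -catA [rep i.+1 _ ++ _]rep10_rcons.
apply: (@next_record_rep10 1 3 w100) => //; apply: next_suffix_end => [|e ec].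
  by have := q10_gt0 i; lia.
have ei : e.+1 <= i by lia.
(* The bound is twice the first inequality plus the second. *)
by have := pq10_ratio_le ei; have := pq10_golden_lt i e.+1; lia.
Qed.

Lemma next_end i c :
  c < i ->
  next_record (bin_val (rep i w10 ++ 'b0 ++ rep c.+1 w10 ++ 'b1))
              (bin_val (rep (i + c).+1 w10 ++ [:: true; true])).
Proof.
move=> ci; rewrite -addSn -rep_cat -catA [rep i.+1 _ ++ _]rep10_rcons.
apply: next_record_rep10_nil; apply: next_suffix_end => [|e ec].
  by have := q10_gt0 i; lia.
have ei : e.+1 <= i by lia.
by have := pq10_ratio_le ei; lia.
Qed.

(** The leading [false] pads the last record with one bit less to the common length; the common
    prefix is empty. *)
Lemma next_start_even c :
  next_record (bin_val (false :: rep c.+2 w10 ++ 'b1))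
              (bin_val (w100 ++ 'b0 ++ rep c w10 ++ [:: true; true])).
Proof. exact: (@next_suffix_record 0 1 [::]) (next_suffix_start_even c). Qed.

Lemma next_start_odd c :
  0 < c ->
  next_record (bin_val (false :: rep c.+1 w10 ++ [:: true; true]))
              (bin_val (w100 ++ 'b0 ++ rep c w10 ++ 'b1)).
Proof. by move/next_suffix_start_odd; apply: (@next_suffix_record 0 1 [::]). Qed.

Lemma next_second_odd c :
  1 < c ->
  next_record (bin_val (w100 ++ 'b0 ++ rep c.+2 w10 ++ 'b1))
    (bin_val (w100 ++ [:: true; false; false] ++ rep c w10 ++ [:: false; true; true])).
Proof. by move/next_suffix_second_odd; apply: (@next_suffix_record 1 3 w100). Qed.

Lemma next_third_odd c :
  next_record
    (bin_val (w100 ++ [:: true; false; false] ++ rep c w10 ++ [:: false; true; true]))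
    (bin_val (w100 ++ w10 ++ 'b0 ++ rep c.+1 w10 ++ 'b1)).
Proof.
rewrite [rep c.+1 _ ++ _]rep10_rcons.
(* Both words begin with [100100], whose pair is $(4,11)$, followed by [c] blocks; then [011]
   becomes [101]. *)
apply: (@next_record_rep10 4 11 [:: true; false; false; true; false; false]) => //.
by apply: next_suffix_swap; have := q10_gt0 c; lia.
Qed.

Lemma bin_val_lt w : bin_val w < 2 ^ size w.
Proof. by have := foldl_append_bounds 0 w; rewrite mul1n => /andP[]. Qed.

Lemma stern_bin_val w : stern (bin_val w) = run 0 1 w.
Proof. exact: stern_run. Qed.

(** * The lists of records *)

(** A decidable form for the short lists: each number is compared with the preceding record only,
    not with all smaller numbers. *)
Definition next_recordb x y :=
  let sx := stern x in
  [&& x < y, sx < stern y & all (fun v => stern v <= sx) (iota x (y - x))].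

Lemma path_chain p s : path next_recordb p s -> chain p s.
Proof.
elim: s p => //= x s IH p /andP[/and3P[px ltx /allP maxx] /IH]; split=> //.
by split=> // v pvx; apply: maxx; rewrite mem_iota; lia.
Qed.

Lemma kbit_path p s k :
  [&& 0 < k, p < 2 ^ k.-1, stern p == fib k, path next_recordb p s, last p s < 2 ^ k
    & stern (last p s) == fib k.+1] ->
  kbit_record_setters k = s.
Proof.
by case/and5P=> k0 pk /eqP fp /path_chain cs /andP[lk /eqP]; apply: kbit_chain.
Qed.

Lemma chain_even n :
  6 <= n -> chain (bin_val (false :: rep (n - 1) w10 ++ 'b1)) (even_list n).
Proof.
move=> n6; rewrite /even_list.
have -> : n - 2 = (n - 3).+1 by lia.
have -> : n./2 = (n./2 - 1).+1 by lia.
apply: (chain_map (f := fun a => bin_val (w100 ++ rep a w10 ++ 'b0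
         ++ rep (n - 3 - a) w10 ++ [:: true; true]))).
- have -> : n - 1 = (n - 3).+2 by lia.
  by rewrite subn0; apply: next_start_even.
- move=> a an; have -> : n - 3 - a = (n - 3 - a.+1).+1 by lia.
  exact: next_shift2_100.
apply: (chain_map (f := fun b => bin_val (rep b w10 ++ 'b0 ++ rep (n - b - 1) w10 ++ 'b1))).
(* The second family begins with [10] and [0], that is with [w100], so the passage to it is a swap
   behind that prefix. *)
- rewrite add0n subnn; have -> : n - 1 - 1 = (n - 3).+1 by lia.
  exact: next_swap_100.
- move=> b bn; have -> : n - b - 1 = (n - b.+1 - 1).+1 by lia.
  by apply: next_shift1; lia.
(* Here [b] equals [n./2], the first index at which [next_shift1] no longer applies and [next_end]
   does. *)
split=> //; set b := 1 + _.
have -> : n - b - 1 = (n - b - 2).+1 by lia.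
have -> : n - 1 = (b + (n - b - 2)).+1 by lia.
by apply: next_end; lia.
Qed.

Lemma chain_odd n :
  6 <= n -> chain (bin_val (false :: rep (n - 1) w10 ++ [:: true; true])) (odd_list n).
Proof.
move=> n6; rewrite /odd_list.
have -> : uphalf n - 1 = (uphalf n - 2).+1 by lia.
have -> : n - 1 = (n - 2).+1 by lia.
split; first by apply: next_start_odd; lia.
split.
  have -> : n - 2 = (n - 4).+2 by lia.
  by apply: next_second_odd; lia.
apply: (chain_map (f := fun b => bin_val (w100 ++ rep b w10 ++ 'b0
         ++ rep (n - 2 - b) w10 ++ 'b1))).
- have -> : n - 2 - 1 = (n - 4).+1 by lia.
  exact: next_third_odd.
- move=> b bn; have -> : n - 2 - b = (n - 2 - b.+1).+1 by lia.
  by apply: next_shift1_100; lia.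
apply: (chain_map (f := fun a => bin_val (rep a.+1 w10 ++ 'b0
         ++ rep (n - 2 - a) w10 ++ [:: true; true]))).
(* Here [b] is [uphalf n - 1], where [next_end_100] takes over from [next_shift1_100]. *)
- set b := 1 + _; have -> : n - 2 - b = (n - b - 3).+1 by lia.
  have -> : n - 2 - 0 = (b + (n - b - 3)).+1 by lia.
  by apply: next_end_100; lia.
- move=> a an; have -> : n - 2 - a = (n - 2 - a.+1).+1 by lia.
  exact: next_shift2.
split=> //; rewrite add0n subnn.
have {2}-> : n = (n - 2).+2 by lia.
exact: next_swap.
Qed.

Lemma kbit_even n : 6 <= n -> kbit_record_setters (2 * n) = even_list n.
Proof.
move=> n6; rewrite mul2n; have n1 : n.*2 = (n - 1).*2.+2 by lia.
have [fib0 fib1] := fib_pq10 (n - 1).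
have lastE : last (bin_val (false :: rep (n - 1) w10 ++ 'b1)) (even_list n) =
    bin_val (rep (n - 1) w10 ++ [:: true; true]) by rewrite /even_list !last_cat.
apply: (@kbit_chain (bin_val (false :: rep (n - 1) w10 ++ 'b1))); rewrite ?lastE.
- lia.
- apply: leq_trans (bin_val_lt (rep (n - 1) w10 ++ 'b1)) _.
  by rewrite leq_exp2l // size_cat size_rep10 /=; lia.
- by rewrite stern_bin_val !runE n1 fibSS fib0 fib1; lia.
- exact: chain_even.
- apply: leq_trans (bin_val_lt _) _.
  by rewrite leq_exp2l // size_cat size_rep10 /=; lia.
- by rewrite stern_bin_val !runE n1 !fibSS fib0 fib1; lia.
Qed.

Lemma kbit_odd n : 6 <= n -> kbit_record_setters (2 * n + 1) = odd_list n.
Proof.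
move=> n6; rewrite mul2n addn1; have n1 : n.*2 = (n - 1).*2.+2 by lia.
have [fib0 fib1] := fib_pq10 (n - 1).
have [fib2 fib3] := fib_pq10 n.
have lastE : last (bin_val (false :: rep (n - 1) w10 ++ [:: true; true]))
    (odd_list n) = bin_val (rep n w10 ++ 'b1).
  by rewrite /odd_list !(last_cat, last_cons).
apply: (@kbit_chain (bin_val (false :: rep (n - 1) w10 ++ [:: true; true])));
  rewrite ?lastE //.
- apply: leq_trans (bin_val_lt (rep (n - 1) w10 ++ [:: true; true])) _.
  by rewrite leq_exp2l // size_cat size_rep10 /=; lia.
- by rewrite stern_bin_val !runE n1 !fibSS fib0 fib1; lia.
- exact: chain_odd.
- apply: leq_trans (bin_val_lt _) _.
  by rewrite leq_exp2l // size_cat size_rep10 /=; lia.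
- by rewrite stern_bin_val !runE fibSS fib2 fib3; lia.
Qed.

Lemma size_kbit k :
  12 <= k -> ((size (kbit_record_setters k))%:Z = ((3 * k) %/ 4)%:Z - (-1) ^+ k)%R.
Proof.
move=> k12; rewrite -signr_odd -(odd_double_half k) oddD odd_double addbF oddb.
case: (odd k); rewrite -mul2n.
  rewrite addnC kbit_odd ?/odd_list /= ?(size_cat, size_map, size_iota) /=; lia.
rewrite add0n kbit_even ?/even_list ?(size_cat, size_map, size_iota) /=; lia.
Qed.

Theorem theorem1 :
  (kbit_record_setters 1 = [:: 1] /\
          kbit_record_setters 2 = [:: 3] /\
          kbit_record_setters 3 = [:: 5] /\
          kbit_record_setters 4 = [:: 9; 11] /\
          kbit_record_setters 5 = [:: 19; 21] /\
          kbit_record_setters 6 = [:: 35; 37; 43] /\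
          kbit_record_setters 7 = [:: 69; 73; 75; 83; 85] /\
          kbit_record_setters 8 = [:: 139; 147; 149; 165; 171] /\
          kbit_record_setters 9 = [:: 277; 293; 299; 331; 339; 341] /\
          kbit_record_setters 10 = [:: 555; 587; 595; 597; 661; 683] /\
          kbit_record_setters 11 = [:: 1109; 1173; 1189; 1195; 1323; 1355; 1363; 1365]) /\
      (forall n : nat, 6 <= n -> kbit_record_setters (2 * n) = even_list n) /\
      (forall n : nat, 6 <= n -> kbit_record_setters (2 * n + 1) = odd_list n) /\
      (forall k : nat, 12 <= k ->
         ((size (kbit_record_setters k))%:Z = ((3 * k) %/ 4)%:Z - (-1) ^+ k)%R).
Proof.
split; last first.
  by split; [exact: kbit_even|split; [exact: kbit_odd|exact: size_kbit]].
do !apply: conj.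
(* For [k = 1] no [p < 1] has the value [fib 1], so the list is computed directly. *)
by vm_compute.
(* From here on the argument is the last entry of the preceding list. *)
by apply: (@kbit_path 1); vm_compute.
by apply: (@kbit_path 3); vm_compute.
by apply: (@kbit_path 5); vm_compute.
by apply: (@kbit_path 11); vm_compute.
by apply: (@kbit_path 21); vm_compute.
by apply: (@kbit_path 43); vm_compute.
by apply: (@kbit_path 85); vm_compute.
by apply: (@kbit_path 171); vm_compute.
by apply: (@kbit_path 341); vm_compute.
by apply: (@kbit_path 683); vm_compute.
Qed.
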